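(* Let $L$ be a triangulation of the $k$-dimensional simplex such that the only vertices of $L$ on the boundary of the simplex are the original vertices of the simplex. Given an arbitrary simplicial complex $K$, all generalized Tchebyshev triangulations of $K$ induced by $L$ have the same $f$-vector.
   Context: Simplicial complexes are finite abstract simplicial complexes, containing the empty face; $k\geq 1$. The link of a face $\sigma$ of $K$ is $\mathrm{link}_K(\sigma)=\{\tau\in K: \sigma\cap\tau=\emptyset,\ \sigma\cup\tau\in K\}$. The $f$-vector of $K$ is $(f_{-1}(K),f_0(K),\ldots,f_{\dim K}(K))$, where $f_i(K)$ is the number of $i$-dimensional faces (faces with $i+1$ vertices). $\partial(L)$ denotes the subcomplex of boundary faces of $L$, which is the boundary complex of the original $k$-simplex; $V(\cdot)$ denotes vertex set. All vertices of $L$ that are not in $V(\partial(L))$ lie in the interior of the simplex. A simplicial complex $K'$ is a generalized Tchebyshev triangulation of $K$ induced by $L$ if there is an ordered list $\sigma_1,\ldots,\sigma_m$ of the $k$-dimensional faces of $K$, listing each exactly once, bijections $\phi_{\sigma_i}:V(\partial(L))\to\sigma_i$, and simplicial complexes $K_0=K,K_1,\ldots,K_m=K'$ such that for each $i\geq 1$ the complex $K_i$ is obtained from $K_{i-1}$ as follows: take an isomorphic copy $L_i$ of $L$ in which each boundary vertex $w\in V(\partial(L))$ is identified with $\phi_{\sigma_i}(w)$ and the interior vertices are new vertices, and replace the family of faces $\{\sigma_i\cup\tau:\tau\in\mathrm{link}_{K_{i-1}}(\sigma_i)\}$ by the family $\{\sigma'\cup\tau:\sigma'\in L_i,\ \tau\in\mathrm{link}_{K_{i-1}}(\sigma_i)\}$.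 *)

(* Defs.v *)
From HB Require Import structures.
From mathcomp Require Import all_boot all_order all_algebra finmap.
From mathcomp Require Import boolp classical_sets reals.

Set Implicit Arguments.
Unset Strict Implicit.
Unset Printing Implicit Defensive.

Import Order.TTheory GRing.Theory Num.Theory.

Local Open Scope fset_scope.

Section AbstractComplexes.
Variable V : choiceType.
Implicit Types (K : {fset {fset V}}) (s t : {fset V}).

(* A finite abstract simplicial complex is the finite set of its faces; its
   vertices are the elements of its faces, so V may be larger (or infinite). *)
Definition simplicial_complex K : Prop :=
  fset0 \in K /\ (forall s t, s \in K -> t `<=` s -> t \in K).

Definition vertices K : {fset V} := \bigcup_(s <- K) s.

Definition link K s : {fset {fset V}} :=
  [fset t in K | (s `&` t == fset0) && (s `|` t \in K)].

(* An i-dimensional face has i + 1 vertices. *)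
Definition dim_faces K (i : nat) : {fset {fset V}} :=
  [fset s in K | #|` s| == i.+1].

(* The list (f_(-1), f_0, ..., f_(dim K)); its entry at index j is f_(j-1),
   the number of faces with j vertices, and its size is dim K + 2. *)
Definition f_vector K : seq nat :=
  mkseq (fun j => #|` [fset s in K | #|` s| == j]|) (\max_(s <- K) #|` s|).+1.

End AbstractComplexes.

Section TchebyshevTriangulations.
Variables W V : choiceType.
(* dL is the boundary subcomplex of L. *)
Variables L dL : {fset {fset W}}.
Implicit Types (K : {fset {fset V}}) (sigma : {fset V}).

(* The values of phi outside vertices dL are irrelevant. *)
Definition boundary_bijection (phi : W -> V) sigma : Prop :=
  {in vertices dL &, injective phi} /\ phi @` vertices dL = sigma.

(* psi is the vertex map of an isomorphism from L to its copy. *)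
Definition subdivision_step sigma (phi : W -> V) K K' : Prop :=
  exists psi : W -> V,
    [/\ {in vertices L &, injective psi},
        {in vertices dL, psi =1 phi},
        (forall w, w \in vertices L -> w \notin vertices dL ->
           psi w \notin vertices K)
      & K' = (K `\` [fset sigma `|` t | t in link K sigma])
             `|` [fset (psi @` s) `|` t | s : {fset W} in L, t : {fset V} in link K sigma]].

Definition tchebyshev_triangulation (k : nat) K K' : Prop :=
  exists (sigmas : seq {fset V}) (phi : {fset V} -> W -> V)
         (Ks : nat -> {fset {fset V}}),
    [/\ uniq sigmas /\ sigmas =i dim_faces K k,
        (forall sigma, sigma \in sigmas ->
           boundary_bijection (phi sigma) sigma),
        (forall i, (i <= size sigmas)%N -> simplicial_complex (Ks i)),
        Ks 0%N = K /\ Ks (size sigmas) = K'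
      & forall i, (i < size sigmas)%N ->
          let sigma := nth fset0 sigmas i in
          subdivision_step sigma (phi sigma) (Ks i) (Ks i.+1)].

End TchebyshevTriangulations.

Section GeometricTriangulations.
Variables (R : realType) (d : nat).
Local Notation point := 'rV[R]_d.
Implicit Types (B s t : {fset point}) (L : {fset {fset point}}).
Local Open Scope ring_scope.

Definition conv s : set point :=
  fun x => exists c : point -> R,
    [/\ forall v, v \in s -> 0 <= c v,
        \sum_(v <- s) c v = 1
      & x = \sum_(v <- s) c v *: v].

Definition affinely_independent s : Prop :=
  forall c : point -> R,
    \sum_(v <- s) c v = 0 -> \sum_(v <- s) c v *: v = 0 ->
    forall v, v \in s -> c v = 0.

(* B is the vertex set of a geometric k-simplex, namely conv B. *)
Definition simplex_vertices (k : nat) B : Prop :=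
  #|` B| = k.+1 /\ affinely_independent B.

(* The boundary of the simplex conv B, relative to its affine hull: the union
   of its proper faces. *)
Definition simplex_boundary B : set point :=
  fun x => exists2 s, s `<` B & conv s x.

(* L is a geometric simplicial complex, each face being given by its set of
   vertices, whose underlying space is conv B. *)
Definition triangulation B L : Prop :=
  [/\ simplicial_complex L,
      forall s, s \in L -> affinely_independent s,
      forall s t, s \in L -> t \in L ->
        (conv s `&` conv t = conv (s `&` t)%fset)%classic
    & forall x, conv B x <-> exists2 s, s \in L & conv s x].

Definition boundary_subcomplex B L : {fset {fset point}} :=
  [fset s in L | `[< (conv s `<=` simplex_boundary B)%classic >]].

End GeometricTriangulations.

(* Main.v *)
Require Import Defs.
From mathcomp Require Import all_boot all_order all_algebra finmap.
From mathcomp Require Import boolp classical_sets reals.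

(** Every face of a subdivided complex lies over a face of the original one, so
    faces can be counted separately over each face of [K]. Call the vertices of
    [K] old, and all vertices introduced by the steps new. The faces processed
    by the steps contain only old vertices, so all that matters of a face at
    any stage is its set [A] of old vertices and the number [b] of its new ones.
    A step at [sigma] keeps the faces that do not contain [sigma], and replaces
    a face with data [(A, b)], where [A] contains [sigma], by one face for each
    face [s] of [L] that meets the interior of the simplex; its data are
    obtained by exchanging [sigma] in [A] for the part of [sigma] that
    corresponds to the boundary vertices of [s], and by adding to [b] the number
    of interior vertices of [s]. All the other faces that the step adds were
    already present. This is [sum_faces_step]; it makes the number of final
    faces of a given size a sum over the faces of [K] of a number
    [refined_count] defined by a recursion on the list of steps that no longer
    mentions complexes ([face_count_refined]).

    The crux is that this number depends only on the cardinal of [A]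
    ([refined_count_card]), which is shown by induction on that cardinal. Steps
    at faces not contained in [A] do nothing. At the first step whose face
    [sigma] is contained in [A], the pair [(A, b)] splits into pairs whose old
    parts are strictly smaller, because no interior face of [L] contains all the
    boundary vertices; and all the (k + 1)-element subsets of such an old part
    are still to be processed, so the induction hypothesis applies to them. The
    cardinals of these old parts and the increments of [b] are determined by the
    faces of [L], whatever [sigma] and the bijection are. (Exchanging two
    consecutive steps can change the face numbers of the intermediate
    complexes when the bijections differ, hence the need for an induction that
    looks at all the remaining steps at once.)

    The argument breaks down when the whole simplex is a face of [L]. In that
    case [L] has no interior vertex ([full_face_vertices]) and every step leaves
    the complex unchanged ([trivial_step]). Geometry is used nowhere else, apart
    from the remark that all vertices of the boundary of [L] are vertices of the
    simplex. *)

Set Implicit Arguments.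
Unset Strict Implicit.
Unset Printing Implicit Defensive.

Import Order.TTheory GRing.Theory Num.Theory.

Local Open Scope fset_scope.
Local Open Scope nat_scope.

(** * Face numbers *)

Section FaceCounts.
Variable V : choiceType.
Implicit Types (K : {fset {fset V}}) (s t : {fset V}).

Lemma mem_vertices K v : reflect (exists2 s, s \in K & v \in s) (v \in vertices K).
Proof.
rewrite /vertices; apply: (iffP (bigfcupP _ _ _ _)).
  by move=> [s /andP[sK _] vs]; exists s.
move=> [s sK vs]; exists s => //.
by rewrite sK.
Qed.

Lemma face_sub_vertices K s : s \in K -> s `<=` vertices K.
Proof. by move=> sK; apply/fsubsetP => v vs; apply/mem_vertices; exists s. Qed.

(** The dimension, hence the length of the f-vector, can be read off the face
    numbers. *)
Lemma f_vector_eq K1 K2 :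
  (forall j, \sum_(s <- K1) (#|` s| == j : nat) =
             \sum_(s <- K2) (#|` s| == j : nat)) ->
  f_vector K1 = f_vector K2.
Proof.
have sumE K j : #|` [fset s in K | #|` s| == j]|
    = \sum_(s <- K) (#|` s| == j : nat).
  have /perm_size -> : perm_eq [fset s in K | #|` s| == j]
                         [seq s <- K | #|` s| == j].
    apply: uniq_perm; rewrite ?filter_uniq ?fset_uniq // => s.
    by rewrite mem_filter !inE andbC.
  by rewrite size_filter -sum1_count big_mkcond; apply: eq_bigr => s _; case: eqP.
have le_max K K' : (forall j, \sum_(s <- K) (#|` s| == j : nat) =
      \sum_(s <- K') (#|` s| == j : nat)) ->
    (\max_(s <- K) #|` s| <= \max_(s <- K') #|` s|)%N.
  move=> eqK; apply/bigmax_leqP_seq => s sK _.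
  have : (0 < \sum_(t <- K') (#|` t| == #|` s| : nat))%N.
    by rewrite -eqK (big_rem s) //= eqxx.
  rewrite lt0n sum_nat_seq_neq0 => /hasP[t tK' /=].
  by rewrite eqb0 negbK => /eqP <-; apply: leq_bigmax_seq.
move=> eqK; rewrite /f_vector.
have -> : \max_(s <- K1) #|` s| = \max_(s <- K2) #|` s|.
  by apply/eqP; rewrite eqn_leq !le_max.
by apply: eq_mkseq => j; rewrite !sumE.
Qed.

End FaceCounts.

(** * Counting faces from the sizes of their old and new parts *)

Lemma card_glue (W V : choiceType) (D s : {fset W}) (f : W -> V)
    (A : {fset V}) :
  {in D &, injective f} -> f @` D `<=` A ->
  (#|` (A `\` (f @` D)) `|` (f @` (s `&` D))| + #|` D| = #|` A| + #|` s `&` D|)%N.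
Proof.
move=> injf fDA.
have subI w : w \in s `&` D -> w \in D by rewrite inE => /andP[].
have cD : #|` f @` D| = #|` D| by rewrite card_in_imfset.
have cI : #|` f @` (s `&` D)| = #|` s `&` D|.
  by rewrite card_in_imfset //= => x y /subI xD /subI yD; apply: injf.
have /eqP dis : (A `\` (f @` D)) `&` (f @` (s `&` D)) == fset0.
  rewrite -fsubset0; apply/fsubsetP => v; rewrite !inE.
  move=> /andP[/andP[/negP vD _] /imfsetP[w /= wI vE]]; case: vD.
  by rewrite vE; apply: in_imfset; apply: subI.
have := cardfsUI (A `\` (f @` D)) (f @` (s `&` D)).
rewrite dis cardfs0 addn0 => ->.
by rewrite -cI -cD addnAC -(cardfsID (f @` D) A) (fsetIidPr fDA)
   [#|` f @` D| + _]addnC.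
Qed.

Section RefinedCount.
Variables (W : choiceType) (L : {fset {fset W}}) (D : {fset W}).

(** The number of faces with [j] vertices into which the steps at the faces of
    [ss] subdivide a face with old part [A] and [b] new vertices. *)
Fixpoint refined_count (V : choiceType) (phi : {fset V} -> W -> V)
    (ss : seq {fset V}) (j : nat) (A : {fset V}) (b : nat) : nat :=
  if ss is sigma :: ss' then
    if sigma `<=` A then
      \sum_(s <- L | ~~ (s `<=` D))
        refined_count phi ss' j
          ((A `\` sigma) `|` (phi sigma @` (s `&` D))) (b + #|` s `\` D|)%N
    else refined_count phi ss' j A b
  else (#|` A| + b == j)%N.

(** The steps up to the first one inside [A] can be skipped: they do not affect
    [A], and they process no face contained in a subset of [A]. *)
Lemma refined_count_first (V : choiceType) (phi : {fset V} -> W -> V) ss j A b :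
  if has (fun sigma => sigma `<=` A) ss then
    exists sigma ss',
    [/\ sigma \in ss, {subset ss' <= ss}, sigma `<=` A,
        forall rho, rho \in ss -> rho `<=` A -> rho != sigma -> rho \in ss'
      & refined_count phi ss j A b = \sum_(s <- L | ~~ (s `<=` D))
        refined_count phi ss' j
          ((A `\` sigma) `|` (phi sigma @` (s `&` D))) (b + #|` s `\` D|)%N]
  else refined_count phi ss j A b = (#|` A| + b == j)%N.
Proof.
elim: ss => //= sigma ss IH; have [sA|sA] := boolP (sigma `<=` A) => /=.
  exists sigma, ss; split => //.
  - by rewrite mem_head.
  - by move=> rho rs; rewrite inE rs orbT.
  - by move=> rho; rewrite inE => /predU1P[->|//]; rewrite eqxx.
case: ifP IH => // _ [rho [ss' [rss sub rA all_in ->]]].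
exists rho, ss'; split => //.
- by rewrite inE rss orbT.
- by move=> x /sub; rewrite inE orbC => ->.
- move=> x; rewrite inE => /predU1P[->|]; last exact: all_in.
  by rewrite (negPf sA).
Qed.

(** The invariant of the induction on [A]. The faces of [ss] may stick out of
    [A]: this is what lets the property pass to the smaller old parts that a
    step produces, with the same list of pending steps. *)
Definition admissible (V : choiceType) (phi : {fset V} -> W -> V) (ss : seq {fset V}) A :=
  (forall sigma, sigma \in ss ->
     {in D &, injective (phi sigma)} /\ phi sigma @` D = sigma) /\
  (forall sigma, sigma `<=` A -> #|` sigma| = #|` D| -> sigma \in ss).

Hypothesis closedL : forall s t, s \in L -> t `<=` s -> t \in L.
Hypothesis DnL : D \notin L.

(** Since [s] does not contain all of [D], the old part [A'] strictly decreases.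
    In particular [A'] does not contain [sigma], for [sigma] together with
    [A' `\` sigma] would be all of [A]; so the loss of [sigma] from the list of
    pending faces does no harm. *)
Lemma admissible_glue (V : choiceType) (phi : {fset V} -> W -> V) ss A sigma ss' s :
    admissible phi ss A -> sigma \in ss -> {subset ss' <= ss} -> sigma `<=` A ->
    (forall rho, rho \in ss -> rho `<=` A -> rho != sigma -> rho \in ss') ->
    s \in L ->
  let A' := (A `\` sigma) `|` (phi sigma @` (s `&` D)) in
  [/\ (#|` A'| + #|` D| = #|` A| + #|` s `&` D|)%N, (#|` A'| < #|` A|)%N
    & admissible phi ss' A'].
Proof.
move=> [bij full] sss sub sA all_in sL A'.
have [injphi phiD] := bij _ sss.
have cA' : (#|` A'| + #|` D| = #|` A| + #|` s `&` D|)%N.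
  by rewrite /A' -[X in _ `\` X]phiD card_glue // phiD.
have ltD : (#|` s `&` D| < #|` D|)%N.
  apply: fproper_ltn_card; rewrite fproperEneq fsubsetIr andbT.
  apply: contraNneq DnL => sD; apply: (closedL sL); rewrite -sD.
  exact: fsubsetIl.
have ltA : (#|` A'| < #|` A|)%N.
  by rewrite -(ltn_add2r #|` D|) cA' ltn_add2l.
have A'A : A' `<=` A.
  rewrite fsubUset fsubsetDl /= (fsubset_trans _ sA) //.
  rewrite -[X in _ `<=` X]phiD; apply/fsubsetP => v /imfsetP[w /=].
  by rewrite inE => /andP[_ wD] ->; apply: in_imfset.
split=> //; split=> [rho /sub|rho rA' crho]; first exact: bij.
have rA := fsubset_trans rA' A'A.
apply: all_in => //; first exact: full.
apply: contraTneq rA' => ->; apply/negP => sA'.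
have : A `<=` A'.
  apply/fsubsetP => v vA; have [vs|vs] := boolP (v \in sigma).
    exact: (fsubsetP sA').
  by rewrite !inE vs vA.
by move/fsubset_leq_card; rewrite leqNgt ltA.
Qed.

Lemma admissible_has (V : choiceType) (phi : {fset V} -> W -> V) ss A :
  admissible phi ss A ->
  has (fun sigma => sigma `<=` A) ss = (#|` D| <= #|` A|)%N.
Proof.
move=> [bij full]; apply/hasP/idP => [[sigma sss /fsubset_leq_card sA]|leDA].
  have [injphi phiD] := bij _ sss.
  by rewrite -phiD card_in_imfset in sA.
pose sigma := [fset x in take #|` D| A].
have sA : sigma `<=` A by apply/fsubsetP => x; rewrite !inE; apply: mem_take.
exists sigma => //; apply: full => //.
rewrite card_fseq undup_id ?take_uniq ?fset_uniq // size_take_min.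
exact/minn_idPl.
Qed.

(** The key invariance: two runs, even in different complexes, with different
    lists and bijections, split faces with equally large old parts into equally
    many faces of each size. Both runs branch over the same faces of [L], which
    matches their subproblems term by term. *)
Lemma refined_count_card (V1 V2 : choiceType) (phi1 : {fset V1} -> W -> V1)
    (phi2 : {fset V2} -> W -> V2) ss1 ss2 A1 A2 j b :
    #|` A1| = #|` A2| -> admissible phi1 ss1 A1 -> admissible phi2 ss2 A2 ->
  refined_count phi1 ss1 j A1 b = refined_count phi2 ss2 j A2 b.
Proof.
have [n] := ubnP #|` A1|.
elim: n => // n IH in ss1 ss2 A1 A2 b * => ltn eqA ad1 ad2.
have := refined_count_first phi1 ss1 j A1 b.
have := refined_count_first phi2 ss2 j A2 b.
rewrite (admissible_has ad1) (admissible_has ad2) eqA.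
case: ifP => _; last by move=> -> ->.
move=> [s2 [ss2' [in2 sub2 sA2 all2 ->]]] [s1 [ss1' [in1 sub1 sA1 all1 ->]]].
rewrite big_seq_cond [RHS]big_seq_cond; apply: eq_bigr => s /andP[sL _].
have [c1 lt1 ad1'] := admissible_glue ad1 in1 sub1 sA1 all1 sL.
have [c2 lt2 ad2'] := admissible_glue ad2 in2 sub2 sA2 all2 sL.
apply: IH => //; first exact: leq_trans lt1 _.
by apply/eqP; rewrite -(eqn_add2r #|` D|) c1 c2 eqA.
Qed.

End RefinedCount.

(** * One subdivision step, and a sequence of steps *)

Section Process.
Variables (W V : choiceType) (L dL : {fset {fset W}}).
Hypothesis dLL : vertices dL `<=` vertices L.
Hypothesis closedL : forall s t, s \in L -> t `<=` s -> t \in L.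
Implicit Types (K : {fset {fset V}}) (sigma rho : {fset V}).
Local Notation D := (vertices dL).

(** Sorts the faces of [K'] by the face of [K] that they refine. The freshness
    of the interior vertices makes the faces obtained from distinct pairs
    [(rho, s)] distinct, and different from the faces of [K]. Only the faces [s]
    not contained in [D] count: a face [s] properly contained in [D] yields faces
    of [K] that do not contain [sigma], which have been counted already. *)
Lemma sum_faces_step sigma (phi : W -> V) K K' (psi : W -> V) (h : {fset V} -> nat) :
    D \notin L -> simplicial_complex K -> phi @` D = sigma ->
    {in vertices L &, injective psi} -> {in D, psi =1 phi} ->
    (forall w, w \in vertices L -> w \notin D -> psi w \notin vertices K) ->
    K' = (K `\` [fset sigma `|` t | t in link K sigma])
      `|` [fset (psi @` s) `|` t | s : {fset W} in L, t : {fset V} in link K sigma] ->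
  \sum_(rho <- K') h rho =
  \sum_(rho <- K) if sigma `<=` rho
    then \sum_(s <- L | ~~ (s `<=` D)) h ((psi @` s) `|` (rho `\` sigma))
    else h rho.
Proof.
move=> DnL [_ closedK] phiD injpsi psiE fresh K'E.
pose new_face rho (s : {fset W}) := (psi @` s) `|` (rho `\` sigma).
pose out := [seq rho <- K | ~~ (sigma `<=` rho)].
pose star := [seq rho <- K | sigma `<=` rho].
pose inner := [seq s <- L | ~~ (s `<=` D)].
have psiD w : w \in D -> psi w \in sigma.
  by move=> wD; rewrite psiE // -phiD; apply: in_imfset.
have innerP s : s \in inner -> exists2 w, w \in s & (w \in vertices L) && (w \notin D).
  rewrite mem_filter => /andP[/fsubsetPn[w ws wD] sL]; exists w => //.
  by rewrite wD (fsubsetP (face_sub_vertices sL)).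
have linkP t : t \in link K sigma =
    [&& t \in K, sigma `&` t == fset0 & sigma `|` t \in K].
  by rewrite !inE.
have starP rho : rho \in star -> rho `\` sigma \in link K sigma.
  rewrite mem_filter linkP => /andP[srho rhoK].
  rewrite (closedK _ _ rhoK (fsubsetDl _ _)) fsetUDl fsetDv fsetD0.
  rewrite (fsetUidPr _ _ srho) rhoK andbT /=.
  by apply/eqP/fsetP => v; rewrite !inE; case: (v \in sigma); rewrite ?andbF.
have linkK t : t \in link K sigma ->
    (sigma `|` t \in star) && ((sigma `|` t) `\` sigma == t).
  rewrite linkP mem_filter => /and3P[_ /eqP dis ->]; rewrite fsubsetUl /=.
  apply/eqP/fsetP => v; have := in_fsetI sigma t v.
  by rewrite dis !inE; case: (v \in sigma).
(* The trace of a new face on the copy of L determines s, since the rest of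
   rho avoids both sigma and the fresh vertices. *)
have newP rho s w : w \in vertices L -> rho \in star -> s \in L ->
    (psi w \in new_face rho s) = (w \in s).
  move=> wL rhos sL; apply/idP/idP => [|ws]; last by rewrite !inE in_imfset.
  rewrite !inE => /orP[/imfsetP[w' /= w's /injpsi ->]//|].
    exact: (fsubsetP (face_sub_vertices sL)).
  move=> /andP[psiN psir]; have [wD|wD] := boolP (w \in D).
    by rewrite psiD in psiN.
  have := fresh w wL wD; move: rhos; rewrite mem_filter => /andP[_ rhoK].
  by rewrite (fsubsetP (face_sub_vertices rhoK)).
have newN rho s : rho \in star -> s \in inner -> new_face rho s \notin K.
  move=> rhos si; have [w ws /andP[wL wD]] := innerP _ si.
  have sL : s \in L by move: si; rewrite mem_filter => /andP[].
  apply/negP => nK; have := fresh _ wL wD.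
  by rewrite (fsubsetP (face_sub_vertices nK)) // newP.
have -> : \sum_(rho <- K') h rho =
    \sum_(rho <- out ++ [seq new_face rho s | rho <- star, s <- inner]) h rho.
  apply: perm_big; apply: uniq_perm; first exact: fset_uniq.
    rewrite cat_uniq filter_uniq ?fset_uniq //=; apply/andP; split.
      apply/hasPn => _ /allpairsP[[rho s] /= [rhos si ->]].
      by rewrite mem_filter (negPf (newN _ _ rhos si)) andbF.
    apply: allpairs_uniq; rewrite ?filter_uniq ?fset_uniq //.
    move=> _ _ /allpairsP[[r1 s1] /= [r1s s1i ->]]
      /allpairsP[[r2 s2] /= [r2s s2i ->]] /= E.
    have s1L : s1 \in L by move: s1i; rewrite mem_filter => /andP[].
    have s2L : s2 \in L by move: s2i; rewrite mem_filter => /andP[].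
    have eqs : s1 = s2.
      apply/fsetP => w; have [wL|wL] := boolP (w \in vertices L).
        by rewrite -(newP r1 s1) // -(newP r2 s2) // E.
      have outside s : s \in L -> (w \in s) = false.
        by move=> sL; apply: contraNF wL; apply/fsubsetP/face_sub_vertices.
      by rewrite !outside.
    congr pair => //; rewrite -{}eqs in E s2i s2L *.
    (* Off the copy of L, a new face agrees with the face that it refines. *)
    have half r r' : r \in star -> r' \in star -> new_face r s1 = new_face r' s1 ->
        r `<=` r'.
      move=> rs r's En; apply/fsubsetP => v vr.
      have r'S : sigma `<=` r' by move: r's; rewrite mem_filter => /andP[].
      have [vs|vs] := boolP (v \in sigma); first exact: (fsubsetP r'S).
      have : v \in new_face r' s1 by rewrite -En !inE vs vr orbT.
      rewrite !inE => /orP[/imfsetP[w /= ws vE]|/andP[]//].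
      have wL := fsubsetP (face_sub_vertices s1L) _ ws.
      have [wD|wD] := boolP (w \in D); first by rewrite vE psiD in vs.
      have := fresh w wL wD; move: rs; rewrite mem_filter => /andP[_ rK].
      by rewrite -vE (fsubsetP (face_sub_vertices rK)).
    by apply/eqP; rewrite eqEfsubset !half.
  move=> rho; rewrite K'E mem_cat !inE.
  apply/idP/idP => [/orP[/andP[rhoN rhoK]|/imfset2P[s /= sL [t /= tl ->]]]|].
  - rewrite mem_filter rhoK andbT; case: (boolP (sigma `<=` rho)) => //= srho.
    case/negP: rhoN; apply/imfsetP; exists (rho `\` sigma) => /=.
      by apply: starP; rewrite mem_filter srho.
    by rewrite fsetUDl fsetDv fsetD0 (fsetUidPr _ _ srho).
  (* A boundary face s gives a face of K; it cannot contain sigma, as s would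
     then contain D. *)
  - have /andP[stS /eqP stE] := linkK _ tl.
    have [sD|sD] := boolP (s `<=` D); last first.
      apply/orP; right; apply/allpairsP; exists (sigma `|` t, s) => /=.
      by split; rewrite // ?mem_filter ?sD ?sL // /new_face stE.
    rewrite mem_filter; apply/orP; left.
    have psis : psi @` s `<=` sigma.
      by apply/fsubsetP => _ /imfsetP[w /= ws ->]; apply/psiD/(fsubsetP sD).
    move: stS; rewrite mem_filter => /andP[_ stK].
    rewrite (closedK _ _ stK) ?fsetSU // andbT.
    apply: contra DnL => /fsubsetP ssub; apply: (closedL sL).
    apply/fsubsetP => w wD; rewrite -(newP (sigma `|` t) s) //.
    + by rewrite /new_face stE ssub ?psiD.
    + exact: (fsubsetP dLL).
    + by rewrite mem_filter fsubsetUl.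
  - case/orP; first rewrite mem_filter => /andP[srho rhoK].
      apply/orP; left; rewrite rhoK andbT; apply: contra srho.
      by case/imfsetP => t _ ->; apply: fsubsetUl.
    case/allpairsP => -[r s] /= [rs si ->]; apply/orP; right.
    move: si; rewrite mem_filter => /andP[_ sL].
    by apply/imfset2P; exists s => //; exists (r `\` sigma) => //=; apply: starP.
rewrite big_cat big_allpairs_dep /= !big_filter.
rewrite [RHS](bigID (fun rho => sigma `<=` rho)) /=.
rewrite addnC; congr (_ + _); apply: eq_bigr => rho; last by move/negPf->.
by move=> ->; rewrite big_filter.
Qed.

(** The translation of [sum_faces_step] in terms of old parts and numbers of new
    vertices: since the interior vertices are not old, a face [s] of [L]
    contributes the image of [s `&` D] to the former and [s `\` D] to the
    latter. *)
Lemma refined_count_step sigma (phi : {fset V} -> W -> V) ss K K' (V0 : {fset V}) j :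
    D \notin L -> simplicial_complex K -> boundary_bijection dL (phi sigma) sigma ->
    sigma `<=` V0 -> V0 `<=` vertices K ->
    subdivision_step L dL sigma (phi sigma) K K' ->
  \sum_(rho <- K') refined_count L D phi ss j (rho `&` V0) #|` rho `\` V0| =
  \sum_(rho <- K)
     refined_count L D phi (sigma :: ss) j (rho `&` V0) #|` rho `\` V0|.
Proof.
move=> DnL cK [_ phiD] sV0 V0K [psi [injpsi psiE fresh K'E]].
rewrite (sum_faces_step _ DnL cK phiD injpsi psiE fresh K'E) big_seq [RHS]big_seq.
apply: eq_bigr => rho rhoK /=; rewrite fsubsetI sV0 andbT.
case: ifP => // srho; rewrite big_seq_cond [RHS]big_seq_cond.
apply: eq_bigr => s /andP[sL _].
have inV0 w : w \in s -> (psi w \in V0) = (w \in D).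
  move=> ws; have wL := fsubsetP (face_sub_vertices sL) _ ws.
  have [wD|wD] := boolP (w \in D).
    apply: (fsubsetP sV0); rewrite psiE // -[X in _ \in X]phiD.
    exact: in_imfset.
  by apply: contraNF (fresh w wL wD) => /(fsubsetP V0K).
have sL' := fsubsetP (face_sub_vertices sL).
have -> : (psi @` s `|` (rho `\` sigma)) `&` V0 =
    ((rho `&` V0) `\` sigma) `|` (phi sigma @` (s `&` D)).
  apply/fsetP => v; rewrite !inE andb_orl.
  have -> : (v \in psi @` s) && (v \in V0) = (v \in phi sigma @` (s `&` D)) :> bool.
    apply/andP/imfsetP => /= [[/imfsetP[w /= ws ->]]|[w]].
      by rewrite inV0 // => wD; exists w; rewrite ?inE ?ws ?psiE.
    rewrite inE => /andP[ws wD] ->; rewrite -psiE // inV0 // wD.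
    by split=> //; apply: in_imfset.
  by rewrite orbC andbA.
congr refined_count.
have -> : (psi @` s `|` (rho `\` sigma)) `\` V0 =
    (rho `\` V0) `|` (psi @` (s `\` D)).
  apply/fsetP => v; rewrite !inE andb_orr orbC; congr (_ || _).
    by case: (boolP (v \in sigma)) => //= /(fsubsetP sV0) ->.
  apply/andP/imfsetP => /= [[vV0 /imfsetP[w /= ws vE]]|[w]].
    by exists w => //; rewrite inE ws andbT -inV0 // -vE.
  rewrite inE => /andP[wD ws] ->; rewrite inV0 //; split=> //.
  exact: in_imfset.
have -> : #|` s `\` D| = #|` psi @` (s `\` D)|.
  rewrite [RHS]card_in_imfset //= => x y; rewrite !inE => /andP[_ xs] /andP[_ ys].
  by apply: injpsi; apply: sL'.
rewrite -cardfsUI; have -> : (rho `\` V0) `&` (psi @` (s `\` D)) = fset0.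
  apply/fsetP => v; rewrite !inE; apply/negP.
  move=> /andP[/andP[_ vr] /imfsetP[w /=]]; rewrite inE => /andP[wD ws] vE.
  have := fresh w (sL' _ ws) wD.
  by rewrite -vE (fsubsetP (face_sub_vertices rhoK)).
by rewrite cardfs0 addn0.
Qed.

(** A step only destroys faces that contain [sigma], which has at least two
    vertices; so an old vertex stays in use, and cannot be reused as a fresh one
    later. *)
Lemma vertices_step sigma (phi : W -> V) K K' (V0 : {fset V}) :
    simplicial_complex K -> (1 < #|` sigma|) ->
    subdivision_step L dL sigma phi K K' ->
  V0 `<=` vertices K -> V0 `<=` vertices K'.
Proof.
move=> [_ closedK] cs [psi [_ _ _ ->]] V0K; apply/fsubsetP => v vV0.
have /mem_vertices[rho rhoK vr] := fsubsetP V0K _ vV0.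
apply/mem_vertices; exists [fset v]; last by rewrite inE.
rewrite !inE (closedK _ _ rhoK) ?fsub1set // andbT; apply/orP; left.
apply/negP => /imfsetP[t _ vE].
have /fsubset_leq_card : sigma `<=` [fset v] by rewrite vE fsubsetUl.
by rewrite cardfs1 leqNgt cs.
Qed.

(** The sum on the right, with the steps already performed dropped from the
    list, is the same for all the intermediate complexes; after the last step
    it counts the faces with [j] vertices. *)
Lemma face_count_refined (phi : {fset V} -> W -> V) ss Ks (V0 : {fset V}) j :
    D \notin L ->
    (forall i, (i <= size ss) -> simplicial_complex (Ks i)) ->
    (forall i, (i < size ss) -> let sigma := nth fset0 ss i in
       subdivision_step L dL sigma (phi sigma) (Ks i) (Ks i.+1)) ->
    (forall sigma, sigma \in ss -> boundary_bijection dL (phi sigma) sigma) ->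
    (forall sigma, sigma \in ss -> (sigma `<=` V0) && (1 < #|` sigma|)) ->
    V0 `<=` vertices (Ks 0) ->
  \sum_(rho <- Ks (size ss)) (#|` rho| == j : nat) =
  \sum_(rho <- Ks 0) refined_count L D phi ss j (rho `&` V0) #|` rho `\` V0|.
Proof.
move=> DnL; elim: ss Ks => [|sigma ss IH] Ks cK step bij sub V0K.
  by apply: eq_bigr => rho _ /=; rewrite cardfsID.
have sin : sigma \in sigma :: ss by rewrite mem_head.
have /andP[sV0 cs] := sub _ sin.
have c0 : simplicial_complex (Ks 0) by apply: cK.
have st0 : subdivision_step L dL sigma (phi sigma) (Ks 0) (Ks 1).
  exact: (step 0).
rewrite -(refined_count_step ss j DnL c0 (bij _ sin) sV0 V0K st0).
apply: (IH (fun i => Ks i.+1)) => [i ile|i ilt|rho rs|rho rs|].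
- exact: cK.
- exact: (step i.+1).
- by apply: bij; rewrite inE rs orbT.
- by apply: sub; rewrite inE rs orbT.
- exact: vertices_step c0 cs st0 V0K.
Qed.

(** Here [L] consists of faces of the full simplex on [D], so that the faces
    removed by the step are restored with [s = D] and nothing else is added. *)
Lemma trivial_step sigma (phi : W -> V) K K' :
    D \in L -> vertices L `<=` D -> simplicial_complex K ->
    phi @` D = sigma ->
  subdivision_step L dL sigma phi K K' -> K' = K.
Proof.
move=> DL LD [_ closedK] phiD [psi [_ psiE _ ->]].
have psiD : psi @` D = sigma.
  rewrite -phiD; apply/fsetP => v; apply/imfsetP/imfsetP => -[w /= wD ->];
    by exists w; rewrite ?psiE.
have linkP t : t \in link K sigma -> sigma `|` t \in K.
  by rewrite !inE => /and3P[].
apply/fsetP => rho; rewrite in_fsetU in_fsetD.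
apply/idP/idP => [/orP[/andP[]//|/imfset2P[s /= sL [t /= tl ->]]]|rhoK].
  apply: closedK (linkP _ tl) _; rewrite fsetSU // -psiD.
  apply/fsubsetP => _ /imfsetP[w /= ws ->]; apply: in_imfset.
  by apply: (fsubsetP LD); apply: (fsubsetP (face_sub_vertices sL)).
rewrite rhoK andbT; case: imfsetP => //= -[t tl ->].
by apply/imfset2P; exists D => //; exists t => //=; rewrite psiD.
Qed.

Lemma trivial_process (phi : {fset V} -> W -> V) ss Ks :
    D \in L -> (ss != [::] -> vertices L `<=` D) ->
    (forall i, (i <= size ss) -> simplicial_complex (Ks i)) ->
    (forall i, (i < size ss) -> let sigma := nth fset0 ss i in
       subdivision_step L dL sigma (phi sigma) (Ks i) (Ks i.+1)) ->
    (forall sigma, sigma \in ss -> boundary_bijection dL (phi sigma) sigma) ->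
  Ks (size ss) = Ks 0.
Proof.
move=> DL LD cK step bij.
have {}step i : i < size ss -> Ks i.+1 = Ks i.
  move=> ilt; have [_ phiD] := bij _ (mem_nth fset0 ilt).
  apply: (trivial_step DL _ (cK _ (ltnW ilt)) phiD (step _ ilt)).
  by apply: LD; rewrite -size_eq0 -lt0n (leq_ltn_trans _ ilt).
have : size ss <= size ss by [].
by elim: {1 3}(size ss) => // i IH ilt; rewrite step // IH // ltnW.
Qed.

End Process.

(** * Comparison of two triangulations *)

Section TwoProcesses.
Variables (W V : choiceType) (L dL : {fset {fset W}}) (k : nat).
Hypothesis dLL : vertices dL `<=` vertices L.
Hypothesis closedL : forall s t, s \in L -> t `<=` s -> t \in L.

(** The combinatorial content of the theorem. The hypothesis on [vertices L]
    says that either all vertices of [L] are boundary vertices, or no face of [L]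
    contains all the boundary vertices; it is asked only when these vertices are as many as
    those of a k-face, which the existence of a k-face of [K] ensures. *)
Lemma tchebyshev_f_vector (K K1 K2 : {fset {fset V}}) :
    0 < k ->
    (#|` vertices dL| = k.+1 -> vertices dL \in L ->
       vertices L `<=` vertices dL) ->
    tchebyshev_triangulation L dL k K K1 ->
    tchebyshev_triangulation L dL k K K2 ->
  f_vector K1 = f_vector K2.
Proof.
move=> k0 trivL.
move=> [ss1 [phi1 [Ks1 [[u1 mem1] bij1 cK1 [Ks10 <-] step1]]]].
move=> [ss2 [phi2 [Ks2 [[u2 mem2] bij2 cK2 [Ks20 <-] step2]]]].
have cD (phi : W -> V) sigma : boundary_bijection dL phi sigma ->
    #|` vertices dL| = #|` sigma|.
  by move=> [injphi <-]; rewrite card_in_imfset.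
have [DL|DnL] := boolP (vertices dL \in L).
  have LsubD (ss : seq {fset V}) (phi : {fset V} -> W -> V) :
      ss =i dim_faces K k ->
      (forall sigma, sigma \in ss -> boundary_bijection dL (phi sigma) sigma) ->
      ss != [::] -> vertices L `<=` vertices dL.
    rewrite -size_eq0 -lt0n => mem bij lt; apply: trivL => //.
    have sin := mem_nth fset0 lt; rewrite (cD _ _ (bij _ sin)).
    by move: sin; rewrite mem !inE => /andP[_ /eqP].
  rewrite (trivial_process DL (LsubD _ _ mem1 bij1) cK1 step1 bij1) Ks10.
  by rewrite (trivial_process DL (LsubD _ _ mem2 bij2) cK2 step2 bij2) Ks20.
apply: f_vector_eq => j.
have sub (ss : seq {fset V}) : ss =i dim_faces K k ->
    forall sigma, sigma \in ss -> (sigma `<=` vertices K) && (1 < #|` sigma|).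
  move=> mem sigma; rewrite mem !inE => /andP[sK /eqP ->].
  by rewrite face_sub_vertices.
rewrite (face_count_refined dLL closedL j DnL cK1 step1 bij1 (sub _ mem1)) ?Ks10 //.
rewrite (face_count_refined dLL closedL j DnL cK2 step2 bij2 (sub _ mem2)) ?Ks20 //.
rewrite big_seq [RHS]big_seq; apply: eq_bigr => rho rhoK.
have /fsetIidPl -> := face_sub_vertices rhoK.
have closedK : forall s t, s \in K -> t `<=` s -> t \in K.
  by have [] := cK1 0 isT; rewrite Ks10.
have full (ss : seq {fset V}) (phi : {fset V} -> W -> V) : ss =i dim_faces K k ->
    (forall sigma, sigma \in ss -> boundary_bijection dL (phi sigma) sigma) ->
    (#|` vertices dL| = k.+1) -> admissible (vertices dL) phi ss rho.
  move=> mem bij ck; split=> // sigma srho cs; rewrite mem !inE cs ck eqxx andbT.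
  exact: closedK srho.
(* Without k-faces there is no step, and no constraint on the size of D. *)
case: (ss1 =P [::]) => [ss1E|/eqP].
  have : ss2 = [::].
    apply/nilP/negPn; rewrite /nilp -lt0n; apply/negP => lt.
    by have := mem_nth fset0 lt; rewrite mem2 -mem1 ss1E.
  by rewrite ss1E => ->.
rewrite -size_eq0 -lt0n => lt; have sin := mem_nth fset0 lt.
have ck : #|` vertices dL| = k.+1.
  by rewrite (cD _ _ (bij1 _ sin)); move: sin; rewrite mem1 !inE => /andP[_ /eqP].
by apply: refined_count_card => //; apply: full.
Qed.

End TwoProcesses.

(** * Geometric input *)

Section Geometry.
Variables (R : realType) (d : nat).
Local Notation point := 'rV[R]_d.
Implicit Types (B s : {fset point}) (L : {fset {fset point}}).
Local Open Scope ring_scope.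

Lemma conv_vertex s v : v \in s -> conv s v.
Proof.
move=> vs; exists (fun w => (w == v)%:R); split=> [w _||].
- exact: ler0n.
- rewrite (big_fsetD1 v) //= eqxx big_seq big1 ?addr0 // => w.
  by rewrite !inE => /andP[/negPf-> _].
- rewrite (big_fsetD1 v) //= eqxx scale1r big_seq big1 ?addr0 // => w.
  by rewrite !inE => /andP[/negPf-> _]; rewrite scale0r.
Qed.

Lemma conv_fset0 (v : point) : ~ conv fset0 v.
Proof. by move=> [c [_ /eqP]]; rewrite big_seq_fset0 eq_sym oner_eq0. Qed.

(** A vertex [v] of [L] outside [B] would lie in the two faces [[fset v]] and [B]
    of [L], but not in the hull of their common face, which is empty. *)
Lemma full_face_vertices B L :
  triangulation B L -> B \in L -> vertices L `<=` B.
Proof.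
move=> [[_ closedL] _ meet cover] BL; apply/fsubsetP => v /mem_vertices[s sL vs].
have vL : [fset v] \in L by apply: closedL sL _; rewrite fsub1set.
apply: contrapT => /negP vB.
have : (conv [fset v] `&` conv B)%classic v.
  split; first by apply: conv_vertex; rewrite inE.
  by apply/cover; exists s => //; apply: conv_vertex.
rewrite meet // (_ : [fset v] `&` B = fset0); first exact: conv_fset0.
by apply/fsetP => w; rewrite !inE; case: eqP => // ->; rewrite (negPf vB).
Qed.

End Geometry.

Theorem theorem3p3 (R : realType) (d k : nat) (hk : (1 <= k)%N)
    (B : {fset 'rV[R]_d}) (hB : simplex_vertices k B)
    (L : {fset {fset 'rV[R]_d}}) (hL : triangulation B L)
    (hbd : forall v, v \in vertices L -> simplex_boundary B v -> v \in B)
    (V : choiceType) (K : {fset {fset V}}) (hK : simplicial_complex K)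
    (K1 K2 : {fset {fset V}})
    (h1 : tchebyshev_triangulation L (boundary_subcomplex B L) k K K1)
    (h2 : tchebyshev_triangulation L (boundary_subcomplex B L) k K K2) :
  f_vector K1 = f_vector K2.
Proof.
set dL := boundary_subcomplex B L in h1 h2.
have dLL : vertices dL `<=` vertices L.
  apply/fsubsetP => v /mem_vertices[s]; rewrite inE => /andP[sL _] vs.
  by apply/mem_vertices; exists s.
have dLB : vertices dL `<=` B.
  apply/fsubsetP => v vdL; apply: hbd; first exact: (fsubsetP dLL).
  have /mem_vertices[s] := vdL; rewrite !inE => /andP[_ /asboolP sb] vs.
  by apply: sb; apply: conv_vertex.
have [[_ closedL] _ _ _] := hL; have [cB _] := hB.
apply: tchebyshev_f_vector h1 h2 => // ck.
have -> : vertices dL = B.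
  by apply/eqP; rewrite eqEfcard dLB cB ck /=.
exact: full_face_vertices.
Qed.
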